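(* Let $n\ge 1$, $N=2^n$, let $f:\{0,\dots,N-1\}\to\{0,1\}$ have exactly $M$ matches (indices $i$ with $f(i)=1$), where $1\le M\le N$, and let $\theta\in(0,\pi/2]$ be defined by $\cos\theta = 1-M/N$. Let $q=\lfloor \pi/(2\theta)\rfloor$. Then $$q\le \frac{\pi}{2\sqrt2}\sqrt{\frac{N}{M}} = O\!\left(\sqrt{N/M}\right),$$ and the probability $P_s^{(q)}$ that the partial-diffusion search algorithm, run with $q$ iterations, outputs a match satisfies $$P_s^{(q)}\ \ge\ \frac{1+\cos^2\theta}{1+\cos\theta}=\frac{1+\left(1-\frac MN\right)^2}{1+\left(1-\frac MN\right)}.$$ Moreover, the function $x\mapsto \frac{1+(1-x)^2}{1+(1-x)}$ on $(0,1]$ has minimum value $2\sqrt2-2$, attained at $x=2-\sqrt2$.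
   Context: The partial-diffusion search algorithm acts on $n+1$ qubits with basis $|i\rangle\otimes|b\rangle$, $0\le i\le N-1$, $b\in\{0,1\}$ (the last qubit is the workspace). The oracle is the unitary $U_f(|i\rangle\otimes|b\rangle)=|i\rangle\otimes|b\oplus f(i)\rangle$. The partial diffusion operator is $D_p=(H^{\otimes n}\otimes I_1)(2|0\rangle\langle 0|-I_{n+1})(H^{\otimes n}\otimes I_1)$, where $H=\frac{1}{\sqrt2}\begin{pmatrix}1&1\\1&-1\end{pmatrix}$, $|0\rangle$ here is the all-zero basis state of the $n+1$ qubits, and $I_k$ is the $2^k\times 2^k$ identity. The algorithm with $q$ iterations: start from $|0\rangle^{\otimes n}\otimes|0\rangle$; apply $H$ to each of the first $n$ qubits, giving $\frac{1}{\sqrt N}\sum_{i=0}^{N-1}|i\rangle\otimes|0\rangle$; apply $D_pU_f$ ($U_f$ first, then $D_p$) $q$ times; measure the first $n$ qubits and output the result $i$. $P_s^{(q)}$ denotes the probability that the output satisfies $f(i)=1$. *)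

(* Defs.v *)
From mathcomp Require Export all_boot all_order all_algebra.
From mathcomp Require Export reals trigo.
From mathcomp Require Export complex mxtens.

Set Implicit Arguments.
Unset Strict Implicit.
Unset Printing Implicit Defensive.

Import Order.TTheory GRing.Theory Num.Theory.
Local Open Scope ring_scope.

(* The space of n+1 qubits is C^(2^n * 2); the basis vector |i> (x) |b> has
   index [mxtens_index (i, b)], so that operators combine through the Kronecker
   product [*t] and its n-th power [ntensmx _ n]. *)
Section PartialDiffusion.
Variables (R : realType) (n : nat).

Lemma pow2_gt0 : (0 < 2 ^ n)%N. Proof. by rewrite expn_gt0. Qed.

Definition index0 : 'I_(2 ^ n) := Ordinal pow2_gt0.

Definition ket (i : 'I_(2 ^ n)) (b : bool) : 'cV[R[i]]_(2 ^ n * 2) :=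
  delta_mx (mxtens_index (i, inord b)) 0.

(* The coordinates of [ket i b] are real, so its transpose is its adjoint. *)
Definition bra (i : 'I_(2 ^ n)) (b : bool) : 'rV[R[i]]_(2 ^ n * 2) :=
  (ket i b)^T.

Definition hadamard : 'M[R[i]]_2 :=
  \matrix_(i < 2, j < 2)
    (((if (i == 1) && (j == 1) then -1 else 1) / Num.sqrt 2 : R)%:C)%C.

Definition hadamard_data : 'M[R[i]]_(2 ^ n * 2) :=
  ntensmx hadamard n *t (1%:M : 'M[R[i]]_2).

(* U_f = \sum_(i, b) |i, b (+) f i> <i, b| *)
Definition oracle (f : 'I_(2 ^ n) -> bool) : 'M[R[i]]_(2 ^ n * 2) :=
  \sum_(i < 2 ^ n) \sum_(b : bool) ket i (b (+) f i) *m bra i b.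

Definition partial_diffusion : 'M[R[i]]_(2 ^ n * 2) :=
  hadamard_data *m
  (2 *: (ket index0 false *m bra index0 false) - 1%:M) *m
  hadamard_data.

Definition search_state (f : 'I_(2 ^ n) -> bool) (q : nat) :
    'cV[R[i]]_(2 ^ n * 2) :=
  iter q (fun psi => partial_diffusion *m (oracle f *m psi))
    (hadamard_data *m ket index0 false).

(* Born rule for measuring the first n qubits: the workspace qubit is not
   measured, hence the sum over its two values. *)
Definition measure_prob (psi : 'cV[R[i]]_(2 ^ n * 2)) (i : 'I_(2 ^ n)) : R :=
  \sum_(b : 'I_2) Normc.normc (psi (mxtens_index (i, b)) 0) ^+ 2.

Definition success_prob (f : 'I_(2 ^ n) -> bool) (q : nat) : R :=
  \sum_(i < 2 ^ n | f i) measure_prob (search_state f q) i.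

End PartialDiffusion.

(* Main.v *)
Require Import Defs.
From mathcomp Require Import topology normedtype derive.
From mathcomp Require Import ring lra.
Import Order.TTheory GRing.Theory Num.Theory.
Import numFieldNormedType.Exports.
Local Open Scope ring_scope.

(* The orbit of the uniform state stays in the space of states whose amplitude
   at |i> (x) |b> depends only on (f i, b) and vanishes when b = 1 and f i = 0.
   On it D_p U_f acts by a three-term recurrence solved by Chebyshev polynomials
   of the second kind in cos theta, whence
     P_s^(q) = (sin^2 ((q + 1) theta) + sin^2 (q theta)) / (1 + cos theta).
   The numerator is 1 - cos ((2 q + 1) theta) cos theta, and the choice of q
   puts (2 q + 1) theta within theta of pi.  The bound on q comes from
   2 M / N = 2 (1 - cos theta) <= theta^2. *)

(** * Trigonometric inequalities *)

Lemma norm_sin_le (R : realType) (x : R) : 0 <= x -> `|sin x| <= x.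
Proof.
move=> x0; have [|c _] := @MVT_segment R sin cos 0 x x0.
  exact/continuous_subspaceT/continuous_sin.
rewrite sin0 !subr0 => ->.
by rewrite normrM (ger0_norm x0) ler_piMl // cos_max.
Qed.

Lemma one_minus_cos_le (R : realType) (x : R) :
  0 <= x -> 2 * (1 - cos x) <= x ^+ 2.
Proof.
move=> x0; have h0 : 0 <= x / 2 by rewrite divr_ge0.
(* Half-angle formula. The absolute value keeps the base nonnegative for every [x], so squares can
   be compared through their bases. *)
have -> : 2 * (1 - cos x) = (2 * `|sin (x / 2)|) ^+ 2.
  rewrite exprMn real_normK ?num_real // {1}[x]splitr cosD -!expr2 cos2sin2.
  by ring.
have sh := norm_sin_le _ _ h0; have s0 := normr_ge0 (sin (x / 2)).
by rewrite ler_pXn2r ?nnegrE //; lra.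
Qed.

(** The floor gives 2 q theta <= pi < 2 (q + 1) theta; the middle multiple 2 q + 1 is one theta away
    from either end. *)
Lemma floor_pi_bounds (R : realType) (theta : R) (q : nat) :
  0 < theta -> q%:Z = Num.floor (pi / (2 * theta)) ->
  pi - theta < (q.*2.+1)%:R * theta <= pi + theta.
Proof.
move=> t0 qE; have := floor_itv (pi / (2 * theta)).
rewrite -qE -PoszD addn1 -!pmulrn ler_pdivlMr ?mulr_gt0 // ltr_pdivrMr ?mulr_gt0 //.
rewrite -addn1 natrD -[in X in _ -> X]addn1 natrD -muln2 natrM => /andP[h1 h2].
by apply/andP; split; lra.
Qed.

Lemma sin2_sum_lower_bound (R : realType) (theta : R) (q : nat) :
  0 < theta <= pi / 2 -> q%:Z = Num.floor (pi / (2 * theta)) ->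
  1 + cos theta ^+ 2 <= sin (q.+1%:R * theta) ^+ 2 + sin (q%:R * theta) ^+ 2.
Proof.
move=> /andP[t0 tpi] qE; have pi0 := pi_gt0 R.
have c0 : 0 <= cos theta by apply: cos_ge0_pihalf; apply/andP; split; lra.
have /andP[lo hi] := floor_pi_bounds _ _ _ t0 qE.
set s := q.*2.+1%:R * theta in lo hi.
(* Since - cos s = cos |pi - s| and |pi - s| <= theta, this is the monotonicity of the cosine on
   [0, pi]. *)
have cs : cos theta <= - cos s.
  have -> : - cos s = cos `|pi - s|.
    by rewrite cos_norm cosB cospi sinpi; ring.
  have d : `|pi - s| <= theta by rewrite ler_norml; apply/andP; split; lra.
  have d0 := normr_ge0 (pi - s).
  by rewrite leNgt ltr_cos -?leNgt // in_itv /=; apply/andP; split; lra.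
(* Here s and theta are the sum and difference of the two angles a and b, and cos (a + b) cos (a -
   b) = cos^2 a - sin^2 b. *)
have -> : sin (q.+1%:R * theta) ^+ 2 + sin (q%:R * theta) ^+ 2 =
          1 - cos s * cos theta.
  set a := q.+1%:R * theta; set b := q%:R * theta.
  have -> : s = a + b by rewrite /s /a /b -mulrDl -natrD addSn addnn.
  have -> : theta = a - b by rewrite /a /b -mulrBl -natrB // subSnn mul1r.
  have a1 := sin2cos2 a; have b1 := sin2cos2 b.
  by rewrite cosD cosB; ring: a1 b1.
by rewrite expr2; nra.
Qed.

(** * Kronecker powers and sums over product indices *)

Lemma tens_mx11 (A : pzRingType) (m n : nat) :
  (1%:M : 'M[A]_m) *t (1%:M : 'M[A]_n) = 1%:M.
Proof.
apply/matrixP => i j; case: (mxtens_indexP i) => i1 i2.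
case: (mxtens_indexP j) => j1 j2; rewrite tensmxE !mxE -natrM mulnb.
by rewrite (can_eq (@mxtens_indexK _ _)) xpair_eqE.
Qed.

Lemma ntensmx_involutive (A : comPzRingType) (m n : nat) (M : 'M[A]_m) :
  M *m M = 1%:M -> ntensmx M n *m ntensmx M n = 1%:M.
Proof.
(* The recursion behind [ntensmx] starts at exponent one; exponent zero is a separate case. *)
move=> MM; case: n => [|n]; first exact: mul1mx.
rewrite /ntensmx; elim: n => [//|n IHn].
by rewrite [ntensmx_rec _ _]/= tensmx_mul MM IHn tens_mx11.
Qed.

Lemma ntensmx_sym (A : comPzRingType) (m n : nat) (M : 'M[A]_m) :
  M^T = M -> (ntensmx M n)^T = ntensmx M n.
Proof.
move=> MT; case: n => [|n]; first exact: trmx1.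
rewrite /ntensmx; elim: n => [//|n IHn].
by rewrite [ntensmx_rec _ _]/= trmx_tens MT IHn.
Qed.

Lemma sum_mxtens (V : nmodType) (m p : nat) (F : 'I_(m * p) -> V) :
  \sum_k F k = \sum_i \sum_j F (mxtens_index (i, j)).
Proof.
rewrite pair_bigA /= (reindex (@mxtens_index m p)) /=.
  by apply: eq_bigr => -[].
by exists (@mxtens_unindex _ _) => ? _; rewrite (mxtens_indexK, mxtens_unindexK).
Qed.

Lemma sum_if (V : pzRingType) (I : finType) (f : pred I) (a b : V) :
  \sum_i (if f i then b else a) =
  (#|I|%:R - #|[set i | f i]%SET|%:R) * a + #|[set i | f i]%SET|%:R * b.
Proof.
rewrite (bigID f) /= addrC (eq_bigr (fun=> a)) => [|i /negbTE -> //].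
rewrite [X in _ + X](eq_bigr (fun=> b)) => [|i -> //].
by rewrite !sumr_const cardsE -(cardC f) natrD addrAC subrr add0r !mulr_natl.
Qed.

(** * The algorithm on the invariant space of states *)

Section PartialDiffusionSearch.
Variable R : realType.

Lemma hadamard_sym : (hadamard R)^T = hadamard R.
Proof. by apply/matrixP => i j; rewrite !mxE andbC. Qed.

Lemma hadamard_involutive : hadamard R *m hadamard R = 1%:M.
Proof.
have s2 : (Num.sqrt 2 : R) ^+ 2 = 2 by rewrite sqr_sqrtr.
have s0 : (Num.sqrt 2 : R) != 0 by rewrite gt_eqF ?sqrtr_gt0.
apply/matrixP => i j; rewrite !mxE !big_ord_recl big_ord0 !mxE /=.
rewrite addr0 -!rmorphM -rmorphD /=.
case: i => [] [|[|//]] ? ; case: j => [] [|[|//]] ?; rewrite -!val_eqE /=.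
all: by congr (_ %:C)%C; field: s2.
Qed.

(** The sign of the Hadamard matrix sits outside its first column, so each factor contributes 1 /
    sqrt 2. *)
Lemma ntens_hadamard_col0 (n : nat) (i : 'I_(2 ^ n)) :
  ntensmx (hadamard R) n i (index0 n) = (((Num.sqrt 2)^-1 ^+ n : R)%:C)%C.
Proof.
case: n i => [|n] i.
  by rewrite /ntensmx !mxE expr0 -val_eqE /= (ord1 i).
rewrite /ntensmx; elim: n i => [|n IHn] i /=.
  by rewrite mxE andbF expr1 div1r.
have -> : index0 n.+2 = mxtens_index (0, index0 n.+1) :> 'I_(2 * 2 ^ n.+1).
  exact: val_inj.
case: (mxtens_indexP i) => i1 i2; rewrite tensmxE IHn mxE andbF div1r.
by rewrite -rmorphM -exprS.
Qed.

Variable n : nat.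

Local Notation uniform := (hadamard_data R n *m ket R (index0 n) false).
Local Notation scale := ((Num.sqrt 2)^-1 ^+ n : R).

Lemma scale_sqr : scale ^+ 2 = (2 ^ n)%:R^-1.
Proof. by rewrite -exprM mulnC exprM exprVn sqr_sqrtr // exprVn natrX. Qed.

(** Conjugating by the symmetric involution [hadamard_data] carries the reflection about the zero
    state to the reflection about its image, the uniform state. *)
Lemma partial_diffusionE :
  partial_diffusion R n = 2 *: (uniform *m uniform^T) - 1%:M.
Proof.
have HT : (hadamard_data R n)^T = hadamard_data R n.
  by rewrite trmx_tens trmx1 (ntensmx_sym _ _ _ _ hadamard_sym).
have HH : hadamard_data R n *m hadamard_data R n = 1%:M.
  rewrite tensmx_mul mulmx1 (ntensmx_involutive _ _ _ _ hadamard_involutive).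
  exact: tens_mx11.
rewrite /partial_diffusion /bra trmx_mul HT mulmxBr mulmxBl mulmx1 HH.
by rewrite -scalemxAr -scalemxAl !mulmxA.
Qed.

Lemma ord2_inord (x : 'I_2) : x = inord (x == 1 :> nat).
Proof. by apply: val_inj; rewrite /= inordK; case: x => [] [|[|]]. Qed.

Definition amplitudes (f : 'I_(2 ^ n) -> bool) (a b c : R) :
    'cV[R[i]]_(2 ^ n * 2) :=
  \col_k let i := (mxtens_unindex k).1 in
    ((if (mxtens_unindex k).2 == 0 then if f i then b else a
      else if f i then c else 0)%:C)%C.

Lemma amplitudes0 f : uniform = amplitudes f scale scale 0.
Proof.
apply/colP => k; case: (mxtens_indexP k) => i x.
rewrite -colE !mxE !mxtens_indexK /= ntens_hadamard_col0.
have -> : inord 0 = 0 :> 'I_2 by apply: val_inj; rewrite /= inordK.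
by case: (x == 0); case: (f i); rewrite ?mulr1 ?mulr0.
Qed.

Lemma ket_bra_mul (i j : 'I_(2 ^ n)) b c (v : 'cV[R[i]]_(2 ^ n * 2)) k :
  (ket R i b *m bra R j c *m v) k 0 =
  (k == mxtens_index (i, inord b))%:R * v (mxtens_index (j, inord c)) 0.
Proof. by rewrite /bra trmx_delta -mulmxA -rowE mxE big_ord1 !mxE andbT. Qed.

(** Adding [f i] modulo 2 is an involution, so a single term of the double sum reaches row (i,
    b). *)
Lemma oracle_mul (f : 'I_(2 ^ n) -> bool) (v : 'cV[R[i]]_(2 ^ n * 2)) i
    (b : bool) :
  (oracle R f *m v) (mxtens_index (i, inord b)) 0 =
  v (mxtens_index (i, inord (b (+) f i))) 0.
Proof.
have inordI (x y : bool) : (inord x == inord y :> 'I_2) = (x == y).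
  by rewrite -val_eqE /= !inordK; case: x; case: y.
rewrite /oracle mulmx_suml summxE (bigD1 i) //= [X in _ + X]big1 ?addr0 => [|j ji].
  rewrite mulmx_suml summxE big_bool !ket_bra_mul.
  rewrite !(can_eq (@mxtens_indexK _ _)) !xpair_eqE !inordI eqxx /=.
  by case: b; case: (f i); rewrite /= ?mul1r ?mul0r ?add0r ?addr0.
rewrite mulmx_suml summxE big1 // => c _; rewrite ket_bra_mul.
rewrite (can_eq (@mxtens_indexK _ _)) xpair_eqE eq_sym (negbTE ji) /=.
by rewrite mul0r.
Qed.

Lemma oracle_amplitudes (f : 'I_(2 ^ n) -> bool) a b c :
  oracle R f *m amplitudes f a b c = amplitudes f a c b.
Proof.
apply/colP => k; case: (mxtens_indexP k) => i x.
rewrite (ord2_inord x) oracle_mul !mxE !mxtens_indexK /= -!val_eqE /= !inordK.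
- by case: (x == 1 :> nat); case: (f i).
- by case: (x == 1 :> nat).
- by case: (_ (+) _).
Qed.

Lemma uniform_overlap (f : 'I_(2 ^ n) -> bool) a b c (M : nat) :
  #|[set i | f i]%SET| = M ->
  (uniform^T *m amplitudes f a b c) 0 0 =
  ((scale * (((2 ^ n)%:R - M%:R) * a + M%:R * b))%:C)%C.
Proof.
move=> cardM; rewrite (amplitudes0 f) mxE sum_mxtens.
rewrite -cardM -[in (2 ^ n)%:R](card_ord (2 ^ n)) -sum_if mulr_sumr rmorph_sum.
apply: eq_bigr => i _; rewrite !big_ord_recl big_ord0 !mxE !mxtens_indexK /=.
by case: (f i); rewrite -!rmorphM /= mul0r !addr0.
Qed.

Lemma diffusion_amplitudes (f : 'I_(2 ^ n) -> bool) a b c (M : nat) :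
  #|[set i | f i]%SET| = M ->
  let m := ((2 ^ n)%:R - M%:R) / (2 ^ n)%:R * a + M%:R / (2 ^ n)%:R * b in
  partial_diffusion R n *m amplitudes f a b c =
  amplitudes f (2 * m - a) (2 * m - b) (- c).
Proof.
move=> cardM m; have := uniform_overlap _ a b c _ cardM.
rewrite partial_diffusionE; set w := uniform => wv.
rewrite mulmxBl mul1mx -scalemxAl -mulmxA.
rewrite [w^T *m _]mx11_scalar wv mul_mx_scalar /w (amplitudes0 f); apply/colP => k.
case: (mxtens_indexP k) => i x; rewrite !mxE !mxtens_indexK /=.
have N0 : ((2 ^ n)%:R : R) != 0 by rewrite pnatr_eq0 expn_eq0.
have s2 : scale ^+ 2 * (2 ^ n)%:R = 1 by rewrite scale_sqr mulVf.
have -> : 2 = ((2 : R)%:C)%C :> R[i] by rewrite rmorph_nat.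
rewrite -!rmorphM -rmorphN -rmorphD /= /m.
case: (x == 0); case: (f i); congr (_ %:C)%C; try by rewrite ?mulr0 ?sub0r ?oppr0.
  by field: s2.
by field: s2.
Qed.

Lemma measure_amplitudes (f : 'I_(2 ^ n) -> bool) a b c i :
  f i -> measure_prob (amplitudes f a b c) i = b ^+ 2 + c ^+ 2.
Proof.
move=> fi; rewrite /measure_prob !big_ord_recl big_ord0 !mxE !mxtens_indexK /=.
by rewrite fi expr0n /= !addr0 !sqr_sqrtr ?sqr_ge0.
Qed.

Lemma sin_recurrence (theta : R) (q : nat) :
  sin (q.+2%:R * theta) =
  2 * cos theta * sin (q.+1%:R * theta) - sin (q%:R * theta).
Proof.
have -> : q.+2%:R * theta = q.+1%:R * theta + theta.
  by rewrite [in LHS]mulrSr mulrDl mul1r.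
have -> : q%:R * theta = q.+1%:R * theta - theta.
  by rewrite [in RHS]mulrSr mulrDl mul1r addrK.
by rewrite sinD sinB; ring.
Qed.

(** [U k] is the Chebyshev polynomial of the second kind of degree k - 1 at cos theta, with [U 0]
    equal to 0. *)
Lemma search_state_amplitudes (f : 'I_(2 ^ n) -> bool) (M : nat) (theta : R)
    (q : nat) :
  #|[set i | f i]%SET| = M -> cos theta = 1 - M%:R / (2 ^ n)%:R ->
  sin theta != 0 ->
  let U k := sin (k%:R * theta) / sin theta in
  search_state R f q =
  amplitudes f (scale * (U q.+1 - U q)) (scale * U q.+1) (- (scale * U q)).
Proof.
move=> cardM costh sin0 U; elim: q => [|q IHq].
  rewrite /search_state /= (amplitudes0 f) /U mul0r mul1r trigo.sin0 mul0r.
  by rewrite divff // subr0 mulr1 mulr0 oppr0.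
rewrite /search_state iterS -/(search_state R f q) IHq oracle_amplitudes.
rewrite (diffusion_amplitudes _ _ _ _ _ cardM).
have N0 : ((2 ^ n)%:R : R) != 0 by rewrite pnatr_eq0 expn_eq0.
(* After the oracle the mean is scale (cos theta U (q + 1) - U q), and inverting - scale U q about
   it yields scale U (q + 2). *)
have U2 : U q.+2 = 2 * cos theta * U q.+1 - U q.
  by rewrite /U sin_recurrence mulrBl mulrA.
by congr amplitudes; rewrite U2 costh; field.
Qed.

Lemma success_probE (f : 'I_(2 ^ n) -> bool) (M : nat) (theta : R) (q : nat) :
  #|[set i | f i]%SET| = M -> cos theta = 1 - M%:R / (2 ^ n)%:R ->
  sin theta != 0 ->
  success_prob R f q =
  (sin (q.+1%:R * theta) ^+ 2 + sin (q%:R * theta) ^+ 2) / (1 + cos theta).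
Proof.
move=> cardM costh sin0; rewrite /success_prob.
rewrite (search_state_amplitudes _ _ _ _ cardM costh sin0).
rewrite (eq_bigr _ (fun i fi => measure_amplitudes f _ _ _ i fi)).
rewrite sumr_const -cardsE cardM -[_ *+ M]mulr_natl sqrrN !exprMn scale_sqr !exprVn.
have MN : M%:R * (2 ^ n)%:R^-1 = 1 - cos theta by rewrite costh; ring.
rewrite -mulrDr mulrA MN -mulrDl sin2cos2.
(* The factor 1 - cos theta = M / N cancels against sin^2 theta, leaving 1 + cos theta below. *)
have fac : 1 - cos theta ^+ 2 = (1 - cos theta) * (1 + cos theta) by ring.
have : sin theta ^+ 2 != 0 by rewrite expf_neq0.
rewrite sin2cos2 fac mulf_eq0 negb_or => /andP[cm cp].
by field; rewrite cp cm.
Qed.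

End PartialDiffusionSearch.

(** * Number of iterations and conclusion *)

Lemma sqrt_ratio_le (R : realType) (N M : nat) (theta : R) :
  (0 < M)%N -> (0 < N)%N -> 0 < theta -> cos theta = 1 - M%:R / N%:R ->
  theta^-1 <= (Num.sqrt 2)^-1 * Num.sqrt (N%:R / M%:R).
Proof.
move=> M0 N0 t0 costh; have := one_minus_cos_le _ _ (ltW t0).
have M0' : 0 < M%:R :> R by rewrite ltr0n.
have N0' : 0 < N%:R :> R by rewrite ltr0n.
have -> : 2 * (1 - cos theta) = 2 * (M%:R / N%:R) by rewrite costh; ring.
move=> le2; rewrite -sqrtrV // -sqrtrM ?invr_ge0 //.
rewrite -[theta^-1]ger0_norm ?invr_ge0 ?(ltW t0) // -sqrtr_sqr ler_wsqrtr //.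
have -> : 2^-1 * (N%:R / M%:R) = (2 * (M%:R / N%:R))^-1 :> R.
  by field; rewrite !gt_eqF.
by rewrite exprVn lef_pV2 ?posrE ?exprn_gt0 ?mulr_gt0 ?invr_gt0.
Qed.

Lemma iterations_le (R : realType) (N M : nat) (theta : R) (q : nat) :
  (0 < M)%N -> (0 < N)%N -> 0 < theta -> cos theta = 1 - M%:R / N%:R ->
  q%:Z = Num.floor (pi / (2 * theta)) ->
  q%:R <= pi / (2 * Num.sqrt 2) * Num.sqrt (N%:R / M%:R) :> R.
Proof.
move=> M0 N0 t0 costh qE; have := floor_le (pi / (2 * theta)).
rewrite -qE -pmulrn => /le_trans; apply.
rewrite !invfM !mulrA -[leRHS]mulrA ler_wpM2l ?divr_ge0 ?pi_ge0 //.
exact: sqrt_ratio_le.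
Qed.

Theorem mainTheorem1 (R : realType) :
  (forall (n : nat) (f : 'I_(2 ^ n) -> bool) (M : nat) (theta : R) (q : nat),
      (1 <= n)%N ->
      #|[set i | f i]%SET| = M -> (1 <= M <= 2 ^ n)%N ->
      0 < theta <= pi / 2 -> cos theta = 1 - M%:R / (2 ^ n)%:R ->
      q%:Z = Num.floor (pi / (2 * theta)) ->
      [/\ q%:R <= pi / (2 * Num.sqrt 2) * Num.sqrt ((2 ^ n)%:R / M%:R) :> R,
          success_prob R f q >= (1 + cos theta ^+ 2) / (1 + cos theta) &
          (1 + cos theta ^+ 2) / (1 + cos theta) =
          (1 + (1 - M%:R / (2 ^ n)%:R) ^+ 2) / (1 + (1 - M%:R / (2 ^ n)%:R))])
  /\
  (exists C : R, 0 < C /\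
    forall (n : nat) (f : 'I_(2 ^ n) -> bool) (M : nat) (theta : R) (q : nat),
      (1 <= n)%N ->
      #|[set i | f i]%SET| = M -> (1 <= M <= 2 ^ n)%N ->
      0 < theta <= pi / 2 -> cos theta = 1 - M%:R / (2 ^ n)%:R ->
      q%:Z = Num.floor (pi / (2 * theta)) ->
      q%:R <= C * Num.sqrt ((2 ^ n)%:R / M%:R))
  /\
  (let g (x : R) := (1 + (1 - x) ^+ 2) / (1 + (1 - x)) in
   [/\ 0 < (2 : R) - Num.sqrt 2 <= 1,
       g (2 - Num.sqrt 2) = 2 * Num.sqrt 2 - 2 &
       forall x : R, 0 < x <= 1 -> 2 * Num.sqrt 2 - 2 <= g x]).
Proof.
have Hq (n M q : nat) (theta : R) : (1 <= M <= 2 ^ n)%N ->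
    0 < theta <= pi / 2 -> cos theta = 1 - M%:R / (2 ^ n)%:R ->
    q%:Z = Num.floor (pi / (2 * theta)) ->
    q%:R <= pi / (2 * Num.sqrt 2) * Num.sqrt ((2 ^ n)%:R / M%:R) :> R.
  move=> /andP[M0 _] /andP[t0 _]; apply: iterations_le => //.
  by rewrite expn_gt0.
have r2 : 0 < Num.sqrt 2 :> R by rewrite sqrtr_gt0.
have r2sq : (Num.sqrt 2 : R) ^+ 2 = 2 by rewrite sqr_sqrtr.
split; [|split].
- move=> n f M theta q _ cardM MN th costh qE; split; last by rewrite costh.
    exact: Hq MN th costh qE.
  have /andP[t0 tpi] := th; have pi0 := pi_gt0 R.
  have c0 : 0 <= cos theta by apply: cos_ge0_pihalf; apply/andP; split; lra.
  rewrite (success_probE _ _ _ _ _ _ cardM costh); last first.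
    by rewrite gt_eqF // sin_gt0_pi //; apply/andP; split; lra.
  rewrite ler_pM2r ?invr_gt0; last lra.
  exact: sin2_sum_lower_bound.
(* The explicit constant of the first bound depends on none of [n], [f], [M], so it serves for the
   O-estimate. *)
- exists (pi / (2 * Num.sqrt 2)); split.
    by rewrite divr_gt0 ?pi_gt0 ?mulr_gt0.
  by move=> n f M theta q _ _; exact: Hq.
split.
- by apply/andP; split; nra.
(* At this point 1 - x = sqrt 2 - 1, so the quotient is (4 - 2 sqrt 2) / sqrt 2. *)
- by field: r2sq; rewrite gt_eqF //; lra.
move=> x /andP[x0 x1]; rewrite ler_pdivlMr; last lra.
(* the difference of the two sides is (2 - x - sqrt 2)^2 *)
have := sqr_ge0 (2 - x - Num.sqrt 2); nra.
Qed.
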